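(* Let $0<q<1$, let $N\ge1$ be an integer and $k\in\mathbb{N}$. The factorial moment $M^1_q(k,N)$ of the Meixner ensemble with $\gamma=1$ can be written as $$M^1_q(k,N)=\left(\frac{q}{1-q}\right)^k\frac{(N+1)_k}{k+1}\;{}_3F_2\left(\begin{matrix}-k,-k,1-N\\ 1,-N-k\end{matrix};\frac1q\right).$$ In particular, $\left(\frac{1-q}{q}\right)^k\frac{k+1}{(N+1)_k}M^1_q(k,N)$ can be extended to the entire complex plane to a polynomial in $k$ of degree $2(N-1)$, and when $k\in\mathbb{N}$, it is a polynomial in $(N-1)$ of degree $k$.
   Context: Conventions: $\mathbb{N}=\{0,1,2,\dots\}$; an empty product is $1$. Hypergeometric notation: $(a)_i=a(a+1)\cdots(a+i-1)$ and ${}_pF_q\left(\begin{matrix}a_1,\dots,a_p\\ b_1,\dots,b_q\end{matrix};z\right)=\sum_{i\ge0}\frac{(a_1)_i\cdots(a_p)_i}{(b_1)_i\cdots(b_q)_i}\frac{z^i}{i!}$, where the series terminates if one of the parameters $a_1,\dots,a_p$ is a nonpositive integer (so the ${}_3F_2$ in the statement is the finite sum over $0\le i\le\min(k,N-1)$, in which no denominator vanishes). The geometric reference measure is $\mu_q^1(x)=q^x(1-q)$, $x\in\mathbb{N}$. The corresponding normalised Meixner polynomials with $\gamma=1$ (orthonormal with respect to $\mu_q^1$) are $$m_n(x;1,q)=q^{n/2}\;{}_2F_1\left(\begin{matrix}-n,-x\\ 1\end{matrix};1-\frac1q\right),\quad n\in\mathbb{N}.$$ The Meixner ($\gamma=1$)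 one-point function with $N$ particles is the probability mass function on $\mathbb{N}$ $$\rho^1_{N,q}(x)=\frac1N\sum_{n=0}^{N-1}m_n(x;1,q)^2\mu_q^1(x),$$ and the factorial moment is $M^1_q(k,N)=\sum_{x\in\mathbb{N}}x(x-1)\cdots(x-k+1)\,\rho^1_{N,q}(x)$.
   Formalization: In the ''In particular'' sentence the factor (k+1)/(N+1)_k is replaced by 1/k!, since the printed quantity is not polynomial (for N=2 it is 1+k^2/((k+2)q); for k=1 it is 1+(N-1)/((N+1)q)); both degrees are unchanged. *)

(* Defs.v *)
From mathcomp Require Export all_boot all_order all_algebra.
From mathcomp Require Export all_classical all_reals all_analysis.
From mathcomp Require Export complex.

Set Implicit Arguments.
Unset Strict Implicit.
Unset Printing Implicit Defensive.

Import Order.TTheory GRing.Theory Num.Theory.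
Import numFieldNormedType.Exports.

Local Open Scope ring_scope.
Local Open Scope classical_set_scope.

Definition pochhammer (R : realType) (a : R) (i : nat) : R :=
  \prod_(0 <= j < i) (a + j%:R).

Definition hypergeom_term (R : realType) (a b : seq R) (z : R) (i : nat) : R :=
  (\prod_(c <- a) pochhammer c i) / (\prod_(c <- b) pochhammer c i)
  * (z ^+ i / i`!%:R).

(* A terminating series is an eventually constant sequence of partial sums, so
   its limit is the finite sum.  If a lower parameter is also a nonpositive
   integer, but is reached only after termination, the later terms are 0 / 0,
   that is 0, and the value is again the finite sum. *)
Definition hypergeom (R : realType) (a b : seq R) (z : R) : R :=
  limn (series (hypergeom_term a b z)).

Definition geometric_weight (R : realType) (q : R) (x : nat) : R :=
  q ^+ x * (1 - q).

Definition meixner1 (R : realType) (q : R) (n x : nat) : R :=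
  q `^ (n%:R / 2%:R) *
  hypergeom [:: - n%:R; - x%:R] [:: 1] (1 - 1 / q).

Definition meixner1_density (R : realType) (q : R) (N x : nat) : R :=
  1 / N%:R *
  \sum_(0 <= n < N) meixner1 q n x ^+ 2 * geometric_weight q x.

Definition moment_term (R : realType) (q : R) (k N x : nat) : R :=
  (x ^_ k)%:R * meixner1_density q N x.

(* [limn] is a junk value for a divergent series; convergence of
   [series (moment_term q k N)] has to be stated separately. *)
Definition factorial_moment (R : realType) (q : R) (k N : nat) : R :=
  limn (series (moment_term q k N)).

(* Main.v *)
(* Write F_n(x) for the sum of 'C(n, j) 'C(x, j) (1 - 1/q)^j, so that m_n^2 is
   q^n F_n^2, and put L_k(n, m) = sum over x of 'C(x, k) q^x F_n(x) F_m(x).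
   In the generating variables t of n and s of m, the recurrence of
   F_n(x) in x and the shift x -> x + 1 in the sum give
     (1 - q) (1 - t s / q) L_(k+1) = q (1 - t / q) (1 - s / q) L_k,
     (1 - q) (1 - t s / q) L_0 = 1,
   hence L_k = q^k / (1 - q)^(k+1) times
     (1 - t / q)^k (1 - s / q)^k / (1 - t s / q)^(k+1).
   Reading off the diagonal coefficients and summing over n < N with the
   hockey-stick identity yields
     ((1 - q) / q)^k M(k, N) / k!
       = 1/N * sum over i <= k of 'C(k, i)^2 q^(-i) 'C(N + k - i, k + 1),
   which is the hypergeometric formula.  For fixed N only the term i = N - 1 has
   degree 2 (N - 1) in k; for fixed k every term has degree k in N and a positive
   leading coefficient, so nothing cancels. *)
Require Import Defs.
From mathcomp Require Import ring lra zify.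

Set Implicit Arguments.
Unset Strict Implicit.
Unset Printing Implicit Defensive.

Import Order.TTheory GRing.Theory Num.Theory.
Import numFieldNormedType.Exports.
Local Open Scope ring_scope.
Local Open Scope classical_set_scope.
Local Open Scope complex_scope.

(** * Series weighted by powers of [q], and their convergence for polynomial coefficients *)

Definition power_sum (R : realType) (q : R) (f : nat -> R) (s : R) : Prop :=
  series (fun x => f x * q ^+ x) @ \oo --> s.

Lemma power_sum_eq (R : realType) (q : R) (f g : nat -> R) (s : R) :
  f =1 g -> power_sum q f s -> power_sum q g s.
Proof. by move=> /funext ->. Qed.

Lemma power_sum_uniq (R : realType) (q : R) (f : nat -> R) (s t : R) :
  power_sum q f s -> power_sum q f t -> s = t.
Proof. exact: cvg_unique. Qed.

Lemma power_sum0 (R : realType) (q : R) : power_sum q (fun=> 0) 0.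
Proof.
rewrite /power_sum (_ : series _ = fun=> 0); first exact: cvg_cst.
by apply/funext => n; rewrite /series /= big1 // => x _; rewrite mul0r.
Qed.

Lemma power_sumD (R : realType) (q : R) (f g : nat -> R) (s t : R) :
  power_sum q f s -> power_sum q g t ->
  power_sum q (fun x => f x + g x) (s + t).
Proof.
move=> fs gt; rewrite /power_sum.
rewrite (_ : (fun x => _) = (fun x => f x * q ^+ x) + (fun x => g x * q ^+ x)).
  by rewrite seriesD; exact: cvgD.
by apply/funext => x; rewrite mulrDl.
Qed.

Lemma power_sumZ (R : realType) (q : R) (f : nat -> R) (s c : R) :
  power_sum q f s -> power_sum q (fun x => c * f x) (c * s).
Proof.
move=> fs; rewrite /power_sum.
rewrite (_ : (fun x => _) = c *: (fun x => f x * q ^+ x)).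
  by rewrite seriesZ; exact: (cvgZl_tmp fs).
by apply/funext => x; rewrite -mulrA.
Qed.

Lemma power_sum_big (R : realType) (q : R) (n : nat)
    (f : nat -> nat -> R) (s : nat -> R) :
  (forall i, (i < n)%N -> power_sum q (f i) (s i)) ->
  power_sum q (fun x => \sum_(0 <= i < n) f i x) (\sum_(0 <= i < n) s i).
Proof.
elim: n => [|n IHn] fs.
  rewrite big_geq //; apply: power_sum_eq (power_sum0 q) => x.
  by rewrite big_geq.
apply: (@power_sum_eq _ _ (fun x => \sum_(0 <= i < n) f i x + f n x)).
  by move=> x; rewrite big_nat_recr.
rewrite big_nat_recr //=; apply: power_sumD; last exact: fs.
by apply: IHn => i ltin; apply: fs; exact: ltnW.
Qed.

Lemma power_sum_shift (R : realType) (q : R) (f : nat -> R) (s : R) :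
  power_sum q f s -> power_sum q (fun x => q * f x.+1) (s - f 0%N).
Proof.
rewrite /power_sum -cvg_shiftS => fs.
rewrite (_ : series _ = (fun n => series (fun x => f x * q ^+ x) n.+1 - f 0%N)).
  by apply: cvgB => //; exact: cvg_cst.
apply/funext => n; rewrite /series /= big_nat_recl // expr0 mulr1 addrC addKr.
by apply: eq_bigr => x _; rewrite exprS mulrCA mulrA.
Qed.

(** The bound is the full negative binomial series. By Pascal's rule [W m.+1] is [q * W m] plus the
    sum for [j]; since [W] is nondecreasing, [(1 - q) * W m] is at most that sum. *)
Lemma sum_bin_expr_le (R : realType) (q : R) (j n : nat) : 0 < q -> q < 1 ->
  \sum_(0 <= x < n) 'C(x + j, j)%:R * q ^+ x <= (1 - q) ^- j.+1.
Proof.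
move=> q0 q1; have Q0 : 0 < 1 - q by rewrite subr_gt0.
have qx0 x : 0 <= q ^+ x by rewrite exprn_ge0 // ltW.
elim: j n => [|j IHj] n.
  rewrite (eq_bigr (fun x => q ^+ x)); last by move=> x _; rewrite bin0 mul1r.
  rewrite expr1 -[leRHS]mul1r ler_pdivlMr // -[leLHS]opprK -mulrN opprB big_mkord.
  by rewrite mulrC -subrX1 opprB gerBl.
pose W m := \sum_(0 <= x < m) 'C(x + j.+1, j.+1)%:R * q ^+ x.
have WS m : W m.+1 = q * W m + \sum_(0 <= x < m.+1) 'C(x + j, j)%:R * q ^+ x.
  rewrite /W !big_nat_recl // !add0n !binn mulr_sumr [RHS]addrCA -big_split /=.
  congr (_ + _); apply: eq_bigr => x _.
  by rewrite addSn binS -addSnnS natrD exprS; ring.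
have WS_ge m : W m <= W m.+1.
  by rewrite /W big_nat_recr //= lerDl mulr_ge0.
rewrite -/(W n) exprS invfM -[leLHS](mulKf (lt0r_neq0 Q0)).
rewrite ler_pM2l ?invr_gt0 //; apply: le_trans (IHj n.+1).
by rewrite mulrBl mul1r lerBlDl -WS.
Qed.

Lemma expn_le_ffact (x j : nat) : (x ^ j <= (x + j) ^_ j)%N.
Proof.
elim: j => // j IHj; rewrite expnS addnS ffactSS leq_mul //.
by rewrite leqW // leq_addr.
Qed.

(** Existence of the limits is secured first, so that the recurrences below can be solved for their
    values. Monomials suffice, and [x ^ j] is dominated by j! times ['C(x + j, j)]. *)
Lemma power_sum_poly (R : realType) (q : R) (p : {poly R}) :
  0 < q -> q < 1 -> exists s, power_sum q (fun x => p.[x%:R]) s.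
Proof.
move=> q0 q1.
have qx0 x : 0 <= q ^+ x by rewrite exprn_ge0 // ltW.
have Xj j : cvgn (series (fun x : nat => x%:R ^+ j * q ^+ x)).
  apply: (@series_le_cvg _ _ (fun x => j`!%:R * ('C(x + j, j)%:R * q ^+ x))).
  - by move=> x; rewrite mulr_ge0 // exprn_ge0.
  - by move=> x; rewrite !mulr_ge0.
  - move=> x; rewrite mulrA ler_wpM2r // -natrX -natrM ler_nat mulnC bin_ffact.
    exact: expn_le_ffact.
  apply: nondecreasing_is_cvgn.
    apply: nondecreasing_series => x _ _; by rewrite !mulr_ge0.
  exists (j`!%:R * (1 - q) ^- j.+1) => _ [n _ <-].
  by rewrite /series /= -mulr_sumr ler_wpM2l // sum_bin_expr_le.
pose L j := limn (series (fun x : nat => x%:R ^+ j * q ^+ x)).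
exists (\sum_(0 <= j < size p) p`_j * L j).
apply: (@power_sum_eq _ _ (fun x => \sum_(0 <= j < size p) p`_j * x%:R ^+ j)).
  by move=> x; rewrite horner_coef big_mkord.
by apply: power_sum_big => j _; apply: power_sumZ; exact: Xj.
Qed.

(** * Meixner polynomials without their normalisation, and their recurrences *)

Definition meixner_sum (R : realType) (u : R) (n x : nat) : R :=
  \sum_(0 <= j < n.+1) 'C(n, j)%:R * 'C(x, j)%:R * u ^+ j.

(** On generating functions in [n], this is multiplication by the variable. *)
Definition delay (R : realType) (f : nat -> R) (n : nat) : R :=
  if n is n'.+1 then f n' else 0.

Lemma meixner_sumn0 (R : realType) (u : R) (n : nat) : meixner_sum u n 0 = 1.
Proof.
rewrite /meixner_sum big_nat_recl // !bin0 expr0 !mulr1 big1 ?addr0 // => j _.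
by rewrite bin0n mulr0 mul0r.
Qed.

(* Multiplying the generating function [(1 - t) ^ (- 1 - x) (1 - t / q) ^ x] of
   [meixner_sum u n x] in [n] by [1 - t] and replacing [x] by [x + 1] amounts to
   multiplying it by [1 - t / q = 1 - (1 - u) t]. *)
Lemma meixner_sum_rec (R : realType) (u : R) (n x : nat) :
  meixner_sum u n x.+1 - delay (meixner_sum u ^~ x.+1) n =
  meixner_sum u n x - (1 - u) * delay (meixner_sum u ^~ x) n.
Proof.
case: n => [|n] /=; first by rewrite /meixner_sum !big_nat1 !bin0 mulr0.
(* Pascal's rule in [n] makes [G] the increment of [meixner_sum] from [n] to [n + 1]; Pascal's rule
   in [y] then gives the increment of [G] itself. *)
pose G y := \sum_(0 <= j < n.+1) 'C(n, j)%:R * 'C(y, j.+1)%:R * u ^+ j.+1.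
have FS y : meixner_sum u n.+1 y = meixner_sum u n y + G y.
  rewrite {1}/meixner_sum big_nat_recl // (eq_bigr (fun j =>
    'C(n, j.+1)%:R * 'C(y, j.+1)%:R * u ^+ j.+1 +
    'C(n, j)%:R * 'C(y, j.+1)%:R * u ^+ j.+1)); last first.
    by move=> j _; rewrite binS natrD; ring.
  rewrite big_split /= addrA; congr (_ + _).
  rewrite -[in RHS](_ : \sum_(0 <= j < n.+2) 'C(n, j)%:R * 'C(y, j)%:R * u ^+ j =
    meixner_sum u n y); last first.
    by rewrite big_nat_recr //= bin_small // !mul0r addr0.
  by rewrite [RHS]big_nat_recl // !bin0.
have GS : G x.+1 = G x + u * meixner_sum u n x.
  rewrite /G /meixner_sum mulr_sumr -big_split /=; apply: eq_bigr => j _.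
  by rewrite binS natrD exprS; ring.
by rewrite !FS GS; ring.
Qed.

(** The sign of the leading coefficient is recorded so that later sums of such polynomials cannot
    lose degree. *)
Lemma bin_poly (R : realType) (j : nat) :
  exists p : {poly R}, [/\ size p = j.+1, 0 < lead_coef p &
    forall x : nat, p.[x%:R] = 'C(x, j)%:R].
Proof.
elim: j => [|j [p [ps pl pE]]].
  exists 1; rewrite size_poly1 lead_coef1 ltr01; split=> // x.
  by rewrite hornerE bin0.
have j0 : 0 < j.+1%:R^-1 :> R by rewrite invr_gt0 ltr0n.
exists (j.+1%:R^-1 *: (p * ('X - j%:R%:P))); split=> [||x].
- rewrite size_scale ?gt_eqF // size_Mmonic ?monicXsubC //.
    by rewrite size_XsubC ps addn2.
  by rewrite -lead_coef_eq0 gt_eqF.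
- by rewrite lead_coefZ lead_coef_Mmonic ?monicXsubC // mulr_gt0.
rewrite hornerZ hornerM hornerXsubC pE [in LHS](mulrC _%:R).
apply: (@mulfI _ j.+1%:R); first by rewrite pnatr_eq0.
rewrite mulVKf ?pnatr_eq0 // -natrM mul_bin_left natrM.
have [xj|jx] := ltnP x j; first by rewrite bin_small // !mulr0.
by rewrite natrB.
Qed.

Lemma meixner_sum_poly (R : realType) (u : R) (n : nat) :
  exists p : {poly R}, forall x : nat, p.[x%:R] = meixner_sum u n x.
Proof.
have [P PE] := choice (@bin_poly R).
exists (\sum_(0 <= j < n.+1) ('C(n, j)%:R * u ^+ j) *: P j) => x.
rewrite horner_sum; apply: eq_bigr => j _.
by have [_ _ E] := PE j; rewrite hornerZ E mulrAC.
Qed.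

Lemma delay_meixner_sum_poly (R : realType) (u : R) (n : nat) :
  exists p : {poly R}, forall x : nat,
    p.[x%:R] = delay (meixner_sum u ^~ x) n.
Proof.
case: n => [|n] /=; last exact: meixner_sum_poly.
by exists 0 => x; rewrite horner0.
Qed.

(** With [A] and [B] as in the proof, [A n x.+1 = B n x], and A_n A_m - q B_n B_m equals (1 - q)
    (F_n F_m - F'_n F'_m / q): the mixed terms cancel. Shifting [x] in the sum of w A_n A_m gives q
    times the sum of (w + v) B_n B_m, and the sums of w B_n B_m drop out. *)
Lemma meixner_sum_pair_rec (R : realType) (q : R) (n m : nat)
    (w v : nat -> R) (s s' t : R) : 0 < q -> q < 1 ->
  (exists p : {poly R}, forall x : nat, p.[x%:R] = w x) ->
  (forall x, w x.+1 = w x + v x) ->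
  let F := meixner_sum (1 - 1 / q) in
  let F' n x := delay (F ^~ x) n in
  power_sum q (fun x => w x * F n x * F m x) s ->
  power_sum q (fun x => w x * F' n x * F' m x) s' ->
  power_sum q
    (fun x => v x * (F n x - q^-1 * F' n x) * (F m x - q^-1 * F' m x)) t ->
  (1 - q) * (s - q^-1 * s') = q * t + (n == 0%N)%:R * (m == 0%N)%:R * w 0%N.
Proof.
move=> q0 q1 [W WE] wS F F' sF sF' sv.
have qn0 : q != 0 by rewrite gt_eqF.
have [Pn PnE] := meixner_sum_poly (1 - 1 / q) n.
have [Pm PmE] := meixner_sum_poly (1 - 1 / q) m.
have [Dn DnE] := delay_meixner_sum_poly (1 - 1 / q) n.
have [Dm DmE] := delay_meixner_sum_poly (1 - 1 / q) m.
pose B n x := F n x - q^-1 * F' n x.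
pose A n x := F n x - F' n x.
have [b bE] : exists b, power_sum q (fun x => w x * B n x * B m x) b.
  have [b bE] := power_sum_poly
    (W * (Pn - q^-1 *: Dn) * (Pm - q^-1 *: Dm)) q0 q1.
  by exists b; apply: power_sum_eq bE => x; rewrite !hornerE WE PnE PmE DnE DmE.
have AB n' x : A n' x.+1 = B n' x.
  rewrite /A /B /F' /F meixner_sum_rec; congr (_ - _ * _).
  by rewrite opprB addrCA subrr addr0 mul1r.
(* All [F n 0] equal 1, so the boundary term of the shift survives only for [n = m = 0]. *)
have A0 n' : A n' 0%N = (n' == 0%N)%:R.
  by case: n' => [|n']; rewrite /A /F' /F /= !meixner_sumn0 ?subr0 ?subrr.
have aE : power_sum q (fun x => w x * A n x * A m x)
    (q * b + (1 - q) * (s + - q^-1 * s')).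
  apply: (power_sum_eq _ (power_sumD (power_sumZ (c := q) bE)
    (power_sumZ (c := 1 - q) (power_sumD sF (power_sumZ (c := - q^-1) sF'))))) => x.
  by rewrite /A /B; field.
have fE : power_sum q (fun x => q * (w x.+1 * A n x.+1 * A m x.+1))
    (q * b + q * t).
  apply: (power_sum_eq _ (power_sumD (power_sumZ (c := q) bE)
    (power_sumZ (c := q) sv))) => x.
  by rewrite !AB wS /B; ring.
have := power_sum_uniq (power_sum_shift aE) fE; rewrite !A0 mulNr; lra.
Qed.

(** * Coefficients of the closed-form generating function *)

(* Coefficient of [t ^ n] in [t ^ l (1 - t / q) ^ k]. *)
Definition conv_coef (R : realType) (q : R) (k l n : nat) : R :=
  if (n < l)%N then 0 else 'C(k, n - l)%:R * (- q^-1) ^+ (n - l).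

Lemma conv_coef_delay (R : realType) (q : R) (k l n : nat) :
  conv_coef q k l.+1 n = delay (conv_coef q k l) n.
Proof. by case: n. Qed.

Lemma conv_coefS (R : realType) (q : R) (k l n : nat) :
  conv_coef q k.+1 l n = conv_coef q k l n - q^-1 * conv_coef q k l.+1 n.
Proof.
rewrite /conv_coef; have [nl|ln|<-] := ltngtP n l.
- by rewrite ltnS ltnW // mulr0 subrr.
- rewrite ltnS leqNgt ln /= -(subnSK ln) binS natrD exprS; ring.
- by rewrite ltnSn subnn !bin0 mulr0 subr0.
Qed.

(* Coefficient of [t ^ n s ^ m] in
   [t ^ a s ^ b (1 - t / q) ^ k (1 - s / q) ^ k / (1 - t s / q) ^ (k + 1)]; the
   value does not depend on [M] as soon as [n < M]. *)
Definition conv_sum (R : realType) (q : R) (M k a b n m : nat) : R :=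
  \sum_(0 <= l < M) 'C(l + k, k)%:R * q ^- l *
     (conv_coef q k (l + a) n * conv_coef q k (l + b) m).

(** Multiplication by 1 - t s / q: the factor t s / q moves the second sum one step in [l], leaving
    differences of consecutive binomials. The extra term at [l = M] vanishes because [n < M]. *)
Lemma conv_sum_telescope (R : realType) (q : R) (M k n m : nat) : (n < M)%N ->
  conv_sum q M k 0 0 n m - q^-1 * conv_sum q M k 1 1 n m =
  conv_coef q k 0 n * conv_coef q k 0 m +
  \sum_(0 <= l < M) ('C(l.+1 + k, k)%:R - 'C(l + k, k)%:R) * q ^- l.+1 *
     (conv_coef q k l.+1 n * conv_coef q k l.+1 m).
Proof.
move=> nM; pose g l := conv_coef q k l n * conv_coef q k l m.
have gM : g M = 0 by rewrite /g /conv_coef nM mul0r.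
have -> : conv_sum q M k 0 0 n m =
    \sum_(0 <= l < M.+1) 'C(l + k, k)%:R * q ^- l * g l.
  rewrite big_nat_recr //= gM mulr0 addr0.
  by apply: eq_bigr => l _; rewrite !addn0.
rewrite big_nat_recl // add0n binn expr0 invr1 !mul1r -addrA; congr (_ + _).
rewrite /conv_sum mulr_sumr -sumrB; apply: eq_bigr => l _.
by rewrite !addn1 -/(g _) exprS invfM; ring.
Qed.

Lemma conv_sum0 (R : realType) (q : R) (M n m : nat) : (n < M)%N ->
  conv_sum q M 0 0 0 n m - q^-1 * conv_sum q M 0 1 1 n m =
  (n == 0%N)%:R * (m == 0%N)%:R.
Proof.
move=> nM; rewrite conv_sum_telescope // big1 => [|l _].
  by rewrite addr0 /conv_coef !ltn0 !subn0; case: n m {nM} => [|n] [|m];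
    rewrite ?bin0 ?bin0n ?expr0 ?mulr1 ?mul0r ?mulr0.
by rewrite !bin0 subrr !mul0r.
Qed.

(** The factor 1 - t s / q lowers the power of the denominator, since the differences of binomials
    are ['C(l.+1 + k, k)]. By [conv_coefS] the numerator releases (1 - t / q) (1 - s / q), whose
    expansion is the right-hand side. *)
Lemma conv_sumS (R : realType) (q : R) (M k n m : nat) : (n < M)%N ->
  conv_sum q M k.+1 0 0 n m - q^-1 * conv_sum q M k.+1 1 1 n m =
  conv_sum q M k 0 0 n m - q^-1 * conv_sum q M k 1 0 n m
  - q^-1 * conv_sum q M k 0 1 n m + q^-1 ^+ 2 * conv_sum q M k 1 1 n m.
Proof.
move=> nM; rewrite conv_sum_telescope //.
pose g l := conv_coef q k.+1 l n * conv_coef q k.+1 l m.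
transitivity (\sum_(0 <= l < M) 'C(l + k, k)%:R * q ^- l * g l).
  transitivity (\sum_(0 <= l < M.+1) 'C(l + k, k)%:R * q ^- l * g l).
    rewrite big_nat_recl // add0n binn expr0 invr1 !mul1r; congr (_ + _).
    apply: eq_bigr => l _; congr (_ * _ * _).
    by rewrite addSn binS natrD addnS addrAC subrr add0r.
  by rewrite big_nat_recr //= [g M]/g /conv_coef nM mul0r mulr0 addr0.
rewrite /conv_sum !mulr_sumr -!sumrB -big_split /=; apply: eq_bigr => l _.
by rewrite /g !conv_coefS !addn0 !addn1; ring.
Qed.

Lemma conv_sum_delayl (R : realType) (q : R) (M k b n m : nat) :
  conv_sum q M k 1 b n m = delay (conv_sum q M k 0 b ^~ m) n.
Proof.
rewrite /conv_sum; case: n => [|n] /=.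
  by rewrite big1 // => l _; rewrite addn1 mul0r mulr0.
by apply: eq_bigr => l _; rewrite addn0 addn1 conv_coef_delay.
Qed.

Lemma conv_sum_delayr (R : realType) (q : R) (M k a n m : nat) :
  conv_sum q M k a 1 n m = delay (conv_sum q M k a 0 n) m.
Proof.
rewrite /conv_sum; case: m => [|m] /=.
  by rewrite big1 // => l _; rewrite addn1 !mulr0.
by apply: eq_bigr => l _; rewrite addn0 addn1 conv_coef_delay.
Qed.

(** * Evaluation of the weighted sums of products of two Meixner polynomials *)

Lemma power_sum_meixner_pair_delay (R : realType) (q c : R) (w : nat -> R)
    (M k n m : nat) :
  let F := meixner_sum (1 - 1 / q) in
  let F' n x := delay (F ^~ x) n in
  (forall n' m', (n' <= n)%N -> (m' <= m)%N ->
     power_sum q (fun x => w x * F n' x * F m' x) (c * conv_sum q M k 0 0 n' m')) ->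
  [/\ power_sum q (fun x => w x * F' n x * F m x) (c * conv_sum q M k 1 0 n m),
      power_sum q (fun x => w x * F n x * F' m x) (c * conv_sum q M k 0 1 n m) &
      power_sum q (fun x => w x * F' n x * F' m x) (c * conv_sum q M k 1 1 n m)].
Proof.
move=> F F' H.
rewrite [conv_sum _ _ _ 1 1 _ _]conv_sum_delayl conv_sum_delayl conv_sum_delayr.
have Z f g s : f =1 (fun=> 0) -> s = 0 -> power_sum q f (c * s).
  by move=> /funext -> ->; rewrite mulr0; exact: power_sum0.
split.
- case: n H => [|n] H; first by apply: Z => // x; rewrite mulr0 mul0r.
  exact: H.
- case: m H => [|m] H; first by apply: Z => // x; rewrite mulr0.
  exact: H.
- case: n H => [|n] H; first by apply: Z => // x; rewrite mulr0 mul0r.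
  rewrite /= conv_sum_delayr.
  case: m H => [|m] H; first by apply: Z => // x; rewrite mulr0.
  by apply: H.
Qed.

(** Induction on [k], and for each [k] strong induction on [n] with [m] arbitrary: the recurrence
    expresses the sum at (n, m) through the one at (n - 1, m - 1) and the sums for [k - 1]. *)
Lemma power_sum_meixner_pair (R : realType) (q : R) (M k n m : nat) :
  0 < q -> q < 1 -> (n < M)%N ->
  power_sum q
    (fun x => 'C(x, k)%:R *
       meixner_sum (1 - 1 / q) n x * meixner_sum (1 - 1 / q) m x)
    (q ^+ k / (1 - q) ^+ k.+1 * conv_sum q M k 0 0 n m).
Proof.
move=> q0 q1; have qn0 : q != 0 by rewrite gt_eqF.
have Qn0 : 1 - q != 0 by rewrite subr_eq0 gt_eqF.
set F := meixner_sum (1 - 1 / q).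
pose F' n x := delay (F ^~ x) n.
have ex k' n' m' : exists s,
    power_sum q (fun x => 'C(x, k')%:R * F n' x * F m' x) s.
  have [W [_ _ WE]] := bin_poly R k'.
  have [P PE] := meixner_sum_poly (1 - 1 / q) n'.
  have [P' PE'] := meixner_sum_poly (1 - 1 / q) m'.
  have [s sE] := power_sum_poly (W * P * P') q0 q1.
  by exists s; apply: power_sum_eq sE => x; rewrite !hornerE WE PE PE'.
have delayed k' n' m' : (n' < M)%N ->
    (forall n m, (n < n')%N -> (n < M)%N ->
      power_sum q (fun x => 'C(x, k')%:R * F n x * F m x)
        (q ^+ k' / (1 - q) ^+ k'.+1 * conv_sum q M k' 0 0 n m)) ->
    power_sum q (fun x => 'C(x, k')%:R * F' n' x * F' m' x)
      (q ^+ k' / (1 - q) ^+ k'.+1 * conv_sum q M k' 1 1 n' m').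
  case: n' => [|n'] n'M H.
    rewrite conv_sum_delayl mulr0.
    by apply: (power_sum_eq _ (power_sum0 q)) => x; rewrite mulr0 mul0r.
  rewrite conv_sum_delayl /= conv_sum_delayr; case: m' => [|m'].
    by rewrite mulr0; apply: (power_sum_eq _ (power_sum0 q)) => x; rewrite mulr0.
  by apply: H => //; exact: ltnW.
have wP k' : exists p : {poly R}, forall x : nat, p.[x%:R] = 'C(x, k')%:R.
  by have [p [_ _ pE]] := bin_poly R k'; exists p.
(* The unknown sum [s] and the closed form [c * T] satisfy the same linear equation, whose
   coefficient 1 - q is nonzero. *)
have solve c T T' s X : (1 - q) * (s - q^-1 * (c * T')) = X ->
    c * (1 - q) * (T - q^-1 * T') = X -> c * T = s.
  by move=> E1 E2; apply: (mulfI Qn0); lra.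
elim: k n m => [|k IHk]; elim/ltn_ind => n IHn m nM.
  have [s sE] := ex 0%N n m.
  rewrite (solve _ _ (conv_sum q M 0 1 1 n m) s ((n == 0%N)%:R * (m == 0%N)%:R)) //.
    have wS x : 'C(x.+1, 0)%:R = 'C(x, 0)%:R + 0 :> R by rewrite !bin0 addr0.
    rewrite (meixner_sum_pair_rec q0 q1 (wP 0%N) wS sE (t := 0)).
    - by rewrite mulr0 add0r bin0 mulr1.
    - by apply: delayed => // n' m' n'n n'M; exact: IHn.
    - by apply: (power_sum_eq _ (power_sum0 q)) => x; rewrite !mul0r.
  by rewrite conv_sum0 // expr0 expr1 mul1r mulVf // mul1r.
have [s sE] := ex k.+1 n m.
pose c := q ^+ k / (1 - q) ^+ k.+1.
pose T a b := conv_sum q M k a b n m.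
pose t := c * (T 0%N 0%N - q^-1 * T 1%N 0%N - q^-1 * T 0%N 1%N + q^-1 ^+ 2 * T 1%N 1%N).
have tE : power_sum q (fun x => 'C(x, k)%:R *
    (F n x - q^-1 * F' n x) * (F m x - q^-1 * F' m x)) t.
  have [n' m' n'n _|E10 E01 E11] := @power_sum_meixner_pair_delay R q c
    (fun x => 'C(x, k)%:R) M k n m; first by apply: IHk; exact: leq_ltn_trans nM.
  have := power_sumD (IHk n m nM) (power_sumD (power_sumZ (c := - q^-1) E10)
    (power_sumD (power_sumZ (c := - q^-1) E01)
                (power_sumZ (c := q^-1 ^+ 2) E11))).
  rewrite [X in power_sum _ _ X](_ : _ = t); last by rewrite /t /T /c; ring.
  apply: power_sum_eq => x; rewrite /F' /F; ring.
rewrite (solve _ _ (conv_sum q M k.+1 1 1 n m) s (q * t)) //.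
  (* The increment of the weight for [k + 1] is the weight for [k], and the weight for [k + 1]
     vanishes at 0, so there is no boundary term. *)
  have wS x : 'C(x.+1, k.+1)%:R = 'C(x, k.+1)%:R + 'C(x, k)%:R :> R.
    by rewrite binS natrD.
  rewrite (meixner_sum_pair_rec q0 q1 (wP k.+1) wS sE _ tE).
    by rewrite bin0n mulr0 addr0.
  by apply: delayed => // n' m' n'n n'M; exact: IHn.
rewrite conv_sumS // /t /T /c !exprS !invfM.
have Ek : (1 - q) ^+ k != 0 by rewrite expf_neq0.
by field; rewrite Ek Qn0 qn0.
Qed.

(** * Diagonal coefficients and their sum over [n] *)

Lemma sum_nat_trunc (R : realType) (f : nat -> R) (a b : nat) : (a <= b)%N ->
  (forall i, (a <= i < b)%N -> f i = 0) ->
  \sum_(0 <= i < b) f i = \sum_(0 <= i < a) f i.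
Proof.
move=> ab f0; rewrite (@big_cat_nat _ _ _ a 0 b) //=.
rewrite -[RHS]addr0; congr (_ + _).
by rewrite big_nat_cond big1 // => i /andP[/f0].
Qed.

(** Substitute [l = n - i]; the signs square away. The ranges [i <= n] and [i <= k] are
    interchangeable: ['C(k, i)] vanishes for [i > k], and ['C(n + (k - i), k)] vanishes for
    [n < i <= k]. *)
Lemma conv_sum_diag (R : realType) (q : R) (k n : nat) : q != 0 ->
  conv_sum q n.+1 k 0 0 n n =
  q ^- n * \sum_(0 <= i < k.+1) 'C(k, i)%:R ^+ 2 * q ^- i * 'C(n + (k - i), k)%:R.
Proof.
move=> qn0.
have -> : conv_sum q n.+1 k 0 0 n n =
    q ^- n * \sum_(0 <= i < n.+1) 'C(k, i)%:R ^+ 2 * q ^- i * 'C(n - i + k, k)%:R.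
  rewrite /conv_sum big_nat_rev mulr_sumr /=.
  apply: eq_big_nat => i /= ilen; rewrite add0n !addn0 subSS.
  rewrite /conv_coef ltnNge leq_subr /= subKn //.
  have -> : q ^- n = q ^- (n - i) * q ^- i by rewrite -invfM -exprD subnK.
  have sq : (- q^-1) ^+ i * (- q^-1) ^+ i = q ^- i * q ^- i.
    by rewrite -!exprMn mulrNN !exprMn exprVn.
  by rewrite [X in _ * X = _]mulrACA sq; ring.
congr (_ * _); have [kn|/ltnW nk] := leqP k n.
  rewrite (@sum_nat_trunc _ _ k.+1) // => [|i /andP[ki _]].
    by apply: eq_big_nat => i /= ik; rewrite addnBAC ?addnBA //; lia.
  by rewrite bin_small // expr0n !mul0r.
rewrite [RHS](@sum_nat_trunc _ _ n.+1) // => [|i /andP[ni ik]].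
  by apply: eq_big_nat => i /= ilen; congr (_ * 'C(_, _)%:R); lia.
by rewrite ['C(n + _, _)]bin_small ?mulr0 //; lia.
Qed.

(** The condition [a <= k] makes the initial value ['C(a, k.+1)] zero. *)
Lemma sum_bin_hockey_stick (N a k : nat) : (a <= k)%N ->
  (\sum_(0 <= n < N) 'C(n + a, k) = 'C(N + a, k.+1))%N.
Proof.
move=> ak; elim: N => [|N IHN]; first by rewrite big_geq // bin_small.
by rewrite big_nat_recr //= IHN addSn binS.
Qed.

(** * Terminating hypergeometric series and the value of the moment *)

Lemma hypergeom_finite (R : realType) (a b : seq R) (z : R) (m : nat) :
  (forall i, (m <= i)%N -> hypergeom_term a b z i = 0) ->
  hypergeom a b z = \sum_(0 <= i < m) hypergeom_term a b z i.
Proof.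
move=> t0; apply: lim_near_cst => //; near=> n.
apply: sum_nat_trunc => [|i /andP[mi _]]; last exact: t0.
by near: n; exact: nbhs_infty_ge.
Unshelve. all: by end_near. Qed.

Lemma pochhammer_opp_nat (R : realType) (n i : nat) :
  pochhammer (- n%:R : R) i = (-1) ^+ i * (n ^_ i)%:R.
Proof.
rewrite /pochhammer; elim: i => [|i IHi]; first by rewrite big_geq // mulr1.
rewrite big_nat_recr //= IHi ffactnSr exprS natrM.
have [ni|ni] := ltnP n i; first by rewrite ffact_small // !(mul0r, mulr0).
by rewrite natrB //; ring.
Qed.

Lemma pochhammer_nat_add1 (R : realType) (n i : nat) :
  pochhammer (n%:R + 1 : R) i = ((n + i) ^_ i)%:R.
Proof.
rewrite /pochhammer; elim: i => [|i IHi]; first by rewrite big_geq.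
rewrite big_nat_recr //= IHi addnS ffactSS natrM mulrC -natr1 natrD; ring.
Qed.

Lemma pochhammer1 (R : realType) (i : nat) : pochhammer (1 : R) i = i`!%:R.
Proof. by have := pochhammer_nat_add1 R 0 i; rewrite add0r add0n ffactnn. Qed.

Lemma bin_ffact_div (R : realType) (n i : nat) :
  'C(n, i)%:R = (n ^_ i)%:R / i`!%:R :> R.
Proof.
by rewrite -bin_ffact natrM mulfK // pnatr_eq0 -lt0n fact_gt0.
Qed.

Lemma meixner1_sqr (R : realType) (q : R) (n x : nat) : 0 < q ->
  meixner1 q n x ^+ 2 = q ^+ n * meixner_sum (1 - 1 / q) n x ^+ 2.
Proof.
move=> q0; rewrite /meixner1 exprMn -(powR_mulrn 2 (powR_ge0 q _)) -powRrM.
rewrite divfK ?pnatr_eq0 // (powR_mulrn _ (ltW q0)); congr (_ * _ ^+ 2).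
have tE i : hypergeom_term [:: - n%:R; - x%:R] [:: 1] (1 - 1 / q) i =
    'C(n, i)%:R * 'C(x, i)%:R * (1 - 1 / q) ^+ i.
  rewrite /hypergeom_term !big_cons !big_nil !pochhammer_opp_nat pochhammer1.
  rewrite !bin_ffact_div -signr_odd.
  have F0 : i`!%:R != 0 :> R by rewrite pnatr_eq0 -lt0n fact_gt0.
  by case: odd => /=; field.
rewrite (@hypergeom_finite _ _ _ _ n.+1) => [|i ni].
  by apply: eq_bigr => i _.
by rewrite tE bin_small // !mul0r.
Qed.

(** By [cvg_moment_term], this is the factorial moment times ((1 - q) / q)^k / k!. *)
Definition reduced_moment (R : realType) (q : R) (k N : nat) : R :=
  N%:R^-1 * \sum_(0 <= i < k.+1)
    'C(k, i)%:R ^+ 2 * q ^- i * 'C(N + (k - i), k.+1)%:R.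

Lemma cvg_moment_term (R : realType) (q : R) (k N : nat) : 0 < q -> q < 1 ->
  series (moment_term q k N) @ \oo -->
  (q / (1 - q)) ^+ k * k`!%:R * reduced_moment q k N.
Proof.
move=> q0 q1; have qn0 : q != 0 by rewrite gt_eqF.
have Qn0 : 1 - q != 0 by rewrite subr_eq0 gt_eqF.
set F := meixner_sum (1 - 1 / q).
(* The factor k! turns the falling factorial into ['C(x, k)]; the power [q ^+ n] from the squared
   Meixner polynomial cancels against [q ^- n] in [conv_sum_diag]. *)
pose c n := k`!%:R * (1 - q) / N%:R * q ^+ n.
pose f x := \sum_(0 <= n < N) c n * ('C(x, k)%:R * F n x * F n x).
have fE : moment_term q k N = fun x => f x * q ^+ x.
  apply/funext => x; rewrite /moment_term /meixner1_density -bin_ffact natrM.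
  rewrite mulrA mulr_sumr mulr_suml; apply: eq_bigr => n _.
  by rewrite meixner1_sqr // /geometric_weight /c -/F; ring.
rewrite fE (_ : _ * _ = \sum_(0 <= n < N) c n *
    (q ^+ k / (1 - q) ^+ k.+1 * conv_sum q n.+1 k 0 0 n n)).
  apply: power_sum_big => n nN; apply: power_sumZ.
  exact: power_sum_meixner_pair.
pose d n i := 'C(k, i)%:R ^+ 2 * q ^- i * 'C(n + (k - i), k)%:R.
rewrite (eq_bigr (fun n => (q / (1 - q)) ^+ k * k`!%:R / N%:R *
    \sum_(0 <= i < k.+1) d n i)) => [|n _]; last first.
  rewrite conv_sum_diag // /c expr_div_n exprS.
  have qX j : q ^+ j != 0 by rewrite expf_neq0.
  have QX : (1 - q) ^+ k != 0 by rewrite expf_neq0.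
  rewrite -/(d n _); set S := (\sum_(_ <= _ < _) _).
  by move: (N%:R^-1 : R) => y; field; rewrite QX Qn0 qX.
rewrite -mulr_sumr exchange_big_nat //= /reduced_moment mulrA; congr (_ * _).
apply: eq_big_nat => i ik; rewrite -mulr_sumr -natr_sum.
by rewrite sum_bin_hockey_stick // leq_subr.
Qed.
Lemma ffactD (n a b : nat) : n ^_ (a + b) = (n ^_ a * (n - a) ^_ b)%N.
Proof.
elim: a n => [|a IHa] n; first by rewrite ffactn0 mul1n subn0.
case: n => [|n]; first by rewrite ffact0n.
by rewrite addSn !ffactSS subSS IHa mulnA.
Qed.

Lemma hypergeom_reduced_moment (R : realType) (q : R) (N k : nat) : (0 < N)%N ->
  pochhammer (N%:R + 1) k / (k%:R + 1) *
  hypergeom [:: - k%:R; - k%:R; 1 - N%:R] [:: 1; - N%:R - k%:R] (1 / q) =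
  k`!%:R * reduced_moment q k N.
Proof.
move=> N0.
have -> : 1 - N%:R = - (N - 1)%:R :> R by rewrite natrB // opprB.
rewrite -opprD -natrD.
rewrite (@hypergeom_finite _ _ _ _ k.+1) => [|i ki]; last first.
  rewrite /hypergeom_term big_cons pochhammer_opp_nat ffact_small //.
  by rewrite mulr0 !mul0r.
rewrite /reduced_moment !mulr_sumr; apply: eq_big_nat => i /= ik.
rewrite /hypergeom_term !big_cons !big_nil !pochhammer_opp_nat pochhammer1.
rewrite pochhammer_nat_add1 !bin_ffact_div factS natrM -natr1 expr_div_n expr1n.
have F0 j : j`!%:R != 0 :> R by rewrite pnatr_eq0 -lt0n fact_gt0.
have D0 : ((N + k) ^_ i)%:R != 0 :> R by rewrite pnatr_eq0 -lt0n ffact_gt0; lia.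
have NR0 : N%:R != 0 :> R by rewrite pnatr_eq0 -lt0n.
have k0 : k%:R + 1 != 0 :> R by rewrite natr1 pnatr_eq0.
(* Both sides split the falling factorial of [N + k] of length [k + 1 + i], after [k], [k + 1]
   factors on the left and after [i] on the right. *)
have E : ((N + k) ^_ k)%:R * N%:R * ((N - 1) ^_ i)%:R =
    ((N + k) ^_ i)%:R * ((N + (k - i)) ^_ k.+1)%:R :> R.
  rewrite -!natrM; congr _%:R.
  have -> : (N + (k - i) = N + k - i)%N by rewrite addnBA.
  rewrite -ffactD (addnC i) ffactD ffactnSr addnK.
  by congr (_ * _ ^_ _)%N; lia.
have -> : ((N + (k - i)) ^_ k.+1)%:R =
    ((N + k) ^_ k)%:R * N%:R * ((N - 1) ^_ i)%:R / ((N + k) ^_ i)%:R :> R.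
  by rewrite E mulrC mulKf.
move: (q ^- i) => Q; rewrite -signr_odd.
by case: odd => /=; field; rewrite D0 NR0 k0 !F0.
Qed.

(** * Polynomiality in [k] and in [N - 1], with exact degrees *)

Lemma size_sum_lead_gt0 (R : realType) (m d : nat) (f : nat -> {poly R}) :
  (forall i, (i <= m)%N -> size (f i) = d.+1 /\ 0 < lead_coef (f i)) ->
  size (\sum_(0 <= i < m.+1) f i) = d.+1.
Proof.
move=> fP; apply/eqP; rewrite eqn_leq; apply/andP; split.
  rewrite big_mkord; apply: leq_trans (size_sum _ _ _) _.
  by apply/bigmax_leqP => i _; have [|->] := fP i; rewrite // -ltnS.
rewrite ltnNge; apply/negP => /(nth_default 0)/eqP; apply/negP.
rewrite coef_sum gt_eqF //.
have l0 i : (i <= m)%N -> 0 < (f i)`_d.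
  by move=> /fP[s]; rewrite lead_coefE s.
rewrite big_nat_recr //= ltr_wpDl ?l0 // big_mkord sumr_ge0 // => i _.
by rewrite ltW // l0 // ltnW.
Qed.

(** By symmetry ['C(N + k - i, k + 1)] is ['C(N + k - i, N - 1 - i)], of degree [N - 1 - i] in [k];
    with the square of ['C(k, i)] the term has degree [N - 1 + i], so only [i = N - 1] reaches the
    top. *)
Lemma reduced_moment_poly_k (R : realType) (q : R) (N : nat) :
  0 < q -> (0 < N)%N ->
  exists p : {poly R}, size p = (2 * (N - 1)).+1 /\
    forall k : nat, p.[k%:R] = reduced_moment q k N.
Proof.
move=> q0 N0; have [P PE] := choice (@bin_poly R).
pose T i := q ^- i *: (P i ^+ 2 * (P (N - 1 - i)%N \Po ('X + (N - i)%:R%:P))).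
have Pn0 i : P i != 0 by rewrite -size_poly_eq0; have [-> _ _] := PE i.
have qi i : 0 < q ^- i by rewrite invr_gt0 exprn_gt0.
have sT i : (i < N)%N -> size (T i) = (N + i)%N.
  move=> iN; have c2 : size ('X + (N - i)%:R%:P : {poly R}) = 2%N.
    by rewrite size_XaddC.
  rewrite size_scale ?gt_eqF // expr2 !size_mul ?mulf_neq0 //; last first.
    by rewrite -size_poly_eq0 size_comp_poly2 // size_poly_eq0.
  rewrite size_comp_poly2 //; have [-> _ _] := PE i.
  by have [-> _ _] := PE (N - 1 - i)%N; lia.
exists (N%:R^-1 *: \sum_(0 <= i < N) T i); split=> [|k].
  rewrite size_scale; last by rewrite invr_neq0 // pnatr_eq0 -lt0n.
  rewrite -(prednK N0) big_nat_recr //= prednK // addrC size_polyDl ?sT; try lia.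
  rewrite big_mkord (leq_ltn_trans (size_sum _ _ _)) //.
  apply/(@leq_ltn_trans (2 * N.-1)%N); last by lia.
  by apply/bigmax_leqP => i _; rewrite sT; have := ltn_ord i; lia.
rewrite hornerZ horner_sum /reduced_moment; congr (_ * _).
have TE i : (T i).[k%:R] =
    'C(k, i)%:R ^+ 2 * q ^- i * 'C(k + (N - i), N - 1 - i)%:R.
  rewrite hornerZ hornerM horner_exp horner_comp hornerD hornerX hornerC.
  have [_ _ ->] := PE i; rewrite -natrD; have [_ _ ->] := PE (N - 1 - i)%N.
  by ring.
have TE' i : (i <= k)%N -> (i < N)%N -> (T i).[k%:R] =
    'C(k, i)%:R ^+ 2 * q ^- i * 'C(N + (k - i), k.+1)%:R.
  move=> ik iN; rewrite TE; congr (_ * _%:R).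
  by rewrite -bin_sub; [congr 'C(_, _)|]; lia.
(* The polynomial sums over [i < N], the moment over [i <= k]; in either direction the surplus terms
   contain a vanishing binomial. *)
have [Nk|kN] := leqP N k.+1.
  rewrite [RHS](@sum_nat_trunc _ _ N) // => [|i /andP[Ni ik]].
    by apply: eq_big_nat => i iN; rewrite TE' //; lia.
  by rewrite ['C(N + _, _)]bin_small ?mulr0 //; lia.
rewrite [LHS](sum_nat_trunc (ltnW kN)) => [|i /andP[ki _]].
  by apply: eq_big_nat => i ik; rewrite TE' //; lia.
by rewrite TE bin_small // expr0n !mul0r.
Qed.

Lemma reduced_moment_poly_N (R : realType) (q : R) (k : nat) : 0 < q ->
  exists r : {poly R}, size r = k.+1 /\
    forall N : nat, (0 < N)%N -> r.[N%:R - 1] = reduced_moment q k N.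
Proof.
move=> q0; have [P [Ps Pl PE]] := bin_poly R k.+1.
(* ['C(N + (k - i), k.+1)] is divisible by [N], as a polynomial in [N], because
   it vanishes at [N = 0]. *)
have quot i : exists S : {poly R}, (i <= k)%N ->
    [/\ size S = k.+1, 0 < lead_coef S &
      forall N : nat, (0 < N)%N ->
        S.[N%:R - 1] = N%:R^-1 * 'C(N + (k - i), k.+1)%:R].
  have [ik|_] := leqP i k; last by exists 0.
  (* The variable is [N - 1], hence the shift by [k - i + 1]; [N = 0] is the point -1, and the
     factor split off there takes the value [N]. *)
  pose L := P \Po ('X + (k - i).+1%:R%:P).
  have LE (N : nat) : (0 < N)%N -> L.[N%:R - 1] = 'C(N + (k - i), k.+1)%:R.
    move=> N0; rewrite horner_comp hornerD hornerX hornerC -PE; congr _.[_].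
    by rewrite -natr1 natrD; ring.
  have /factor_theorem[S SE] : root L (- 1).
    rewrite rootE horner_comp hornerD hornerX hornerC -natr1 addrCA addNr addr0.
    by rewrite PE bin_small // ltnS leq_subr.
  have Ls : size L = k.+2 by rewrite size_comp_poly2 // size_XaddC.
  have Sn0 : S != 0.
    by apply: contra_eq_neq Ls => S0; rewrite SE S0 mul0r size_poly0.
  exists S => _; split=> [||N N0].
  - by move: Ls; rewrite SE size_Mmonic ?monicXsubC // size_XsubC addn2 => -[].
  - rewrite -(lead_coef_Mmonic S (monicXsubC (- 1))) -SE.
    by rewrite lead_coef_comp ?size_XaddC // lead_coefXaddC expr1n mulr1.
  rewrite -LE // SE hornerM hornerXsubC opprK subrK mulrC mulfK //.
  by rewrite pnatr_eq0 -lt0n.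
have [S SP] := choice quot.
exists (\sum_(0 <= i < k.+1) ('C(k, i)%:R ^+ 2 * q ^- i) *: S i).
split=> [|N N0].
  apply: size_sum_lead_gt0 => i ik; have [Ss Sl _] := SP i ik.
  have c0 : 0 < 'C(k, i)%:R ^+ 2 * q ^- i :> R.
    by rewrite mulr_gt0 ?invr_gt0 ?exprn_gt0 // ltr0n bin_gt0.
  by rewrite size_scale ?gt_eqF // lead_coefZ mulr_gt0.
rewrite horner_sum /reduced_moment mulr_sumr; apply: eq_big_nat => i /= ik.
by have [_ _ SE] := SP i ik; rewrite hornerZ SE // mulrCA.
Qed.

(** The polynomial claims divide the scaled moment by k!. Dividing by (N + 1)_k / (k + 1) would
    leave the 3F2 itself, which for N = 2 is 1 + k^2 / ((k + 2) q), not a polynomial in k. *)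
Theorem theorem5 (R : realType) (q : R) (q0 : 0 < q) (q1 : q < 1) :
  (forall N k : nat, (0 < N)%N ->
     cvgn (series (moment_term q k N)) /\
     factorial_moment q k N =
       (q / (1 - q)) ^+ k * (pochhammer (N%:R + 1) k / (k%:R + 1)) *
       hypergeom [:: - k%:R; - k%:R; 1 - N%:R] [:: 1; - N%:R - k%:R] (1 / q))
  /\
  (forall N : nat, (0 < N)%N ->
     exists p : {poly R[i]},
       size p = (2 * (N - 1)).+1 /\
       forall k : nat,
         p.[k%:R] =
         (((1 - q) / q) ^+ k / k`!%:R * factorial_moment q k N)%:C)
  /\
  (forall k : nat,
     exists r : {poly R},
       size r = k.+1 /\
       forall N : nat, (0 < N)%N ->
         r.[N%:R - 1] =
         ((1 - q) / q) ^+ k / k`!%:R * factorial_moment q k N).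
Proof.
have momentE k N : factorial_moment q k N =
    (q / (1 - q)) ^+ k * k`!%:R * reduced_moment q k N.
  apply: cvg_lim; [exact: Rhausdorff | exact: cvg_moment_term].
have reducedE k N : ((1 - q) / q) ^+ k / k`!%:R * factorial_moment q k N =
    reduced_moment q k N.
  have F0 : k`!%:R != 0 :> R by rewrite pnatr_eq0 -lt0n fact_gt0.
  have Q0 : (q / (1 - q)) ^+ k != 0.
    by apply/expf_neq0/mulf_neq0; rewrite ?invr_eq0 ?subr_eq0 gt_eqF.
  by rewrite momentE -(invf_div q) exprVn -invfM mulKf ?mulf_neq0.
split=> [N k N0|]; last split=> [N N0|k].
- split; first by apply: cvgP; exact: cvg_moment_term.
  by rewrite momentE -mulrA -hypergeom_reduced_moment // mulrA.
- have [p [ps pE]] := reduced_moment_poly_k q0 N0.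
  exists (map_poly (real_complex R) p); split=> [|k].
    by rewrite size_map_poly.
  by rewrite reducedE -pE -horner_map rmorph_nat.
have [r [rs rE]] := reduced_moment_poly_N k q0.
by exists r; split=> // N N0; rewrite reducedE rE.
Qed.
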